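(* Let $J:\mathbb{R}^n\to\mathbb{R}$ be continuously differentiable, and let $s(t)$ be the sinusoidal dither signal with components $s_i(t)=a_i\sin(\omega r_i t)$. Then the average gradient estimate $\bar{\hat g}=(\bar{\hat g}_1,\dots,\bar{\hat g}_n)$, given by $$\bar{\hat g}_i(\theta)=\frac1T\int_0^T m_i(\tau)\,J(\theta+s(\tau))\,d\tau,\qquad m_i(t)=\frac{2}{a_i}\sin(\omega r_i t),\quad T=\frac{2\pi}{\omega},$$ converges to $\nabla J$ as the dither vanishes: for every $\theta\in\mathbb{R}^n$, $\bar{\hat g}(\theta)\to\nabla J(\theta)$ as $a_0\to 0$.
   Context: Here $\omega>0$, each $r_i$ is a fixed nonzero integer, $a_i\neq 0$, and $a_0=\sqrt{\sum_{i=1}^n a_i^2}$. The limit $a_0\to0$ is taken with the ratios $a_i/a_0$ held fixed. The function $\bar{\hat g}_i$ is the average over one period of the gradient estimate $\hat g_i(t,\theta,\xi)=m_i(t)\left(J(\theta+s(t))-\xi\right)$ with $\theta\in\mathbb{R}^n$ and $\xi\in\mathbb{R}$ frozen; it does not depend on $\xi$ because $m_i$ has zero mean over a period.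
   Formalization: The formal statement additionally assumes that the absolute values |r_i| are pairwise distinct; without this the claim fails, e.g. for n=2, r=(1,1), J(x)=x_2, where the first component of the average estimate is a_2/a_1 instead of 0. *)

(* Defs.v *)
From HB Require Import structures.
From mathcomp Require Export all_boot all_order all_algebra.
From mathcomp Require Export all_classical all_reals all_analysis.

Set Implicit Arguments.
Unset Strict Implicit.
Unset Printing Implicit Defensive.
Import Order.TTheory GRing.Theory Num.Theory.
Import numFieldNormedType.Exports.
Local Open Scope classical_set_scope.
Local Open Scope ring_scope.

Section Defs.
Context {R : realType} {n : nat}.
Implicit Types (J : 'rV[R]_n -> R) (a theta c : 'rV[R]_n) (r : 'I_n -> int).

Definition gradient J theta : 'rV[R]_n :=
  \row_i 'D_(delta_mx 0 i) J theta.

Definition continuously_differentiable J : Prop :=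
  (forall theta, differentiable J theta) /\ continuous (gradient J).

Definition dither_amplitude a : R := Num.sqrt (\sum_i a 0 i ^+ 2).

Definition dither omega r a (t : R) : 'rV[R]_n :=
  \row_i (a 0 i * sin (omega * (r i)%:~R * t)).

Definition demodulation omega r a (i : 'I_n) (t : R) : R :=
  2 / a 0 i * sin (omega * (r i)%:~R * t).

Definition average_gradient_estimate J omega r a theta : 'rV[R]_n :=
  let T := 2 * pi / omega in
  \row_i (T^-1 * \int[lebesgue_measure]_(t in `[0, T])
                    (demodulation omega r a i t * J (theta + dither omega r a t))).

(* The limit a_0 -> 0 with nonzero amplitudes whose ratios a_i / a_0 are held
   fixed, equal to c_i. *)
Definition vanishing_dither c : set_system 'rV[R]_n :=
  filter_from [set d : R | 0 < d]
    (fun d => [set a : 'rV[R]_n | [/\ forall i, a 0 i != 0,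
                           forall i, a 0 i / dither_amplitude a = c 0 i
                         & dither_amplitude a < d]]).

Lemma dither_amplitudeZ (e : R) c :
  0 <= e -> dither_amplitude (e *: c) = e * dither_amplitude c.
Proof.
move=> e0; rewrite /dither_amplitude.
under eq_bigr do rewrite mxE exprMn.
by rewrite -mulr_sumr sqrtrM ?sqr_ge0// sqrtr_sqr ger0_norm.
Qed.

#[global] Instance vanishing_dither_filter c : Filter (vanishing_dither c).
Proof.
apply: filter_from_filter; first by exists 1; rewrite /= ltr01.
move=> d e /= d0 e0; exists (Num.min d e); first by rewrite /= lt_min d0.
by move=> a [a0 ac]; rewrite lt_min => /andP[ad ae]; split; split.
Qed.

(* The limit is not vacuous: every unit vector with nonzero coordinates occurs
   as a vector of ratios. *)
Lemma vanishing_dither_proper c :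
  (forall i, c 0 i != 0) -> dither_amplitude c = 1 ->
  ProperFilter (vanishing_dither c).
Proof.
move=> c0 c1; apply: filter_from_proper => d /= d0; exists ((d / 2) *: c).
have d20 : 0 < d / 2 by rewrite divr_gt0.
rewrite /= dither_amplitudeZ ?ltW// c1 mulr1; split => [i|i|].
- by rewrite mxE mulf_neq0// gt_eqF.
- by rewrite mxE mulrAC divff ?mul1r// gt_eqF.
- by rewrite ltr_pdivrMr// ltr_pMr// ltr1n.
Qed.

End Defs.

(* Main.v *)
Require Import Defs.
From mathcomp Require Import ring.

Set Implicit Arguments.
Unset Strict Implicit.
Unset Printing Implicit Defensive.
Import Order.TTheory GRing.Theory Num.Theory.
Import numFieldNormedType.Exports.
Local Open Scope classical_set_scope.
Local Open Scope ring_scope.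

(* Write J (theta + h) = J theta + \sum_j D_j J theta * h_j + o(|h|) along the
   dither h = s t.  Over a period m_i has mean zero, and, the |r_j| being
   nonzero and pairwise distinct, m_i is orthogonal to s_j for j != i while
   m_i s_i has mean one; so the average estimate is exactly the gradient plus
   the average of m_i o(|s|).  As |m_i| <= 2 / |a_i| and |s| <= a_0, the latter
   is at most 2 e a_0 / |a_i| = 2 e / |c_i|, with e -> 0 as a_0 -> 0. *)

Lemma cvg_row (K : numFieldType) (n : nat) (T : Type) (F : set_system T)
    (FF : Filter F) (f : T -> 'rV[K]_n) (l : 'rV[K]_n) :
  (forall i, f x 0 i @[x --> F] --> l 0 i) -> f @ F --> l.
Proof.
move=> fl; apply/cvg_ballP => e e0.
(* Balls of row vectors are taken entrywise, and the finitely many coordinate conditions can be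
   intersected within [F]. *)
have : \forall x \near F, forall i, ball (l 0 i) e (f x 0 i).
  by apply: filter_forall => i; move/cvg_ballP: (fl i); apply.
apply: filterS => x flx; split => // i j; rewrite (ord1 i); exact: flx.
Qed.

(** * Integrals of continuous functions over a segment *)

Section integral.
Context {R : realType}.
Implicit Types (f : R -> R) (a b w T : R).
Notation mu := lebesgue_measure.

Lemma continuous_integrable_itv f a b :
  continuous f -> mu.-integrable `[a, b] (EFin \o f).
Proof.
move=> cf; apply: continuous_compact_integrable; first exact: segment_compact.
exact: continuous_subspaceT.
Qed.

Lemma continuous_sumr (I : Type) (s : seq I) (f : I -> R -> R) :
  (forall i, continuous (f i)) -> continuous (fun t => \sum_(i <- s) f i t).
Proof.
move=> cf t; elim: s => [|i s ih]; last first.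
  by under eq_fun do rewrite big_cons; apply: cvgD (cf i t) ih.
by under eq_fun do rewrite big_nil; exact: cvg_cst.
Qed.

Lemma Rintegral_sum_continuous (I : Type) (s : seq I) (f : I -> R -> R) (a b : R) :
  (forall i, continuous (f i)) ->
  \int[mu]_(t in `[a, b]) (\sum_(i <- s) f i t) =
  \sum_(i <- s) \int[mu]_(t in `[a, b]) f i t.
Proof.
move=> cf; elim: s => [|i s ih].
  under eq_Rintegral do rewrite big_nil.
  by rewrite Rintegral_cst// mul0r big_nil.
under eq_Rintegral do rewrite big_cons.
rewrite big_cons RintegralD ?ih//; apply: continuous_integrable_itv => //.
exact: continuous_sumr.
Qed.

Lemma normr_Rintegral_le (f : R -> R) (a b K : R) : a <= b -> continuous f ->
  (forall t, `|f t| <= K) -> `|\int[mu]_(t in `[a, b]) f t| <= K * (b - a).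
Proof.
move=> ab cf fK; apply: le_trans (le_normr_Rintegral _ _) _ => //.
  exact: continuous_integrable_itv.
have <- : \int[mu]_(t in `[a, b]) K = K * (b - a).
  rewrite Rintegral_cst//= lebesgue_measure_itv/= lte_fin.
  (* The measure of [[a, b]] is given by cases on [a < b]; in the other case [a = b] and both sides
     vanish. *)
  have [_|ba] := ltP a b; first by rewrite -EFinD.
  by rewrite (@le_anti _ _ a b) ?ab// subrr.
apply: le_Rintegral => //; apply: continuous_integrable_itv.
- by move=> t; apply: cvg_norm; exact: cf.
- by move=> t; exact: cvg_cst.
Qed.

Lemma Rintegral_FTC2 f F a b : a < b -> continuous f ->
  (forall x, is_derive x (1 : R) F (f x)) ->
  \int[mu]_(x in `[a, b]) f x = F b - F a.
Proof.
move=> ab cf dF; have cF : continuous F.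
  by move=> x; apply: differentiable_continuous; apply/derivable1_diffP.
rewrite /Rintegral (@continuous_FTC2 _ f F)//.
- exact: continuous_subspaceT.
(* The one-sided limits of the primitive at the endpoints come from its continuity on the whole
   line. *)
- by split => [x _||]; [| exact: cvg_at_right_filter (cF _)
                        | exact: cvg_at_left_filter (cF _)].
- by move=> x _; rewrite derive1E derive_val.
Qed.

(** * Elementary trigonometric integrals and integer multiples of a period *)

Lemma continuousMl w : continuous (fun t : R => w * t).
Proof. by move=> t; apply: cvgM; [exact: cvg_cst | exact: cvg_id]. Qed.

Lemma continuous_sinMl w : continuous (fun t => sin (w * t)).
Proof.
by move=> t; apply: continuous_comp; [exact: continuousMl | exact: continuous_sin].
Qed.

Lemma continuous_cosMl w : continuous (fun t => cos (w * t)).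
Proof.
by move=> t; apply: continuous_comp; [exact: continuousMl | exact: continuous_cos].
Qed.

Lemma Rintegral_cos w T : 0 < T -> w != 0 ->
  \int[mu]_(t in `[0, T]) cos (w * t) = sin (w * T) / w.
Proof.
move=> T0 w0; pose F t := sin (w * t) / w.
have dF x : is_derive x (1 : R) F (cos (w * x)).
  by apply: is_derive_eq; rewrite /GRing.scale/=; field.
rewrite (Rintegral_FTC2 T0 (@continuous_cosMl w) dF) /F.
by rewrite mulr0 sin0 mul0r subr0.
Qed.

Lemma Rintegral_sin w T : 0 < T -> w != 0 ->
  \int[mu]_(t in `[0, T]) sin (w * t) = (1 - cos (w * T)) / w.
Proof.
move=> T0 w0; pose F t := - cos (w * t) / w.
have dF x : is_derive x (1 : R) F (sin (w * x)).
  by apply: is_derive_eq; rewrite /GRing.scale/=; field.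
rewrite (Rintegral_FTC2 T0 (@continuous_sinMl w) dF) /F.
by rewrite mulr0 cos0; field.
Qed.

Lemma periodicz (f : R -> R) T : periodic f T ->
  forall (k : int) x, f (x + k%:~R * T) = f x.
Proof.
move=> fT [k|k] x; first by rewrite -pmulrn mulr_natl periodicn.
(* For a negative multiple, the natural-number case is applied at the shifted base point
   [x - T *+ k.+1]. *)
by rewrite NegzE mulrNz mulNr -pmulrn mulr_natl -{2}(subrK (T *+ k.+1) x) periodicn.
Qed.

Lemma sin_int2pi (k : int) : sin (k%:~R * (pi *+ 2)) = 0 :> R.
Proof. by rewrite -[_ * _]add0r (periodicz (@sinD2pi R)) sin0. Qed.

Lemma cos_int2pi (k : int) : cos (k%:~R * (pi *+ 2)) = 1 :> R.
Proof. by rewrite -[_ * _]add0r (periodicz (@cosD2pi R)) cos0. Qed.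

(** * Orthogonality of sines over one period *)

Section period.
Variable omega : R.
Hypothesis omega_gt0 : 0 < omega.
Let T := 2 * pi / omega.

Let T_gt0 : 0 < T.
Proof. by rewrite divr_gt0// mulr_gt0// pi_gt0. Qed.

Let wkT (k : int) : omega * k%:~R * T = k%:~R * (pi *+ 2).
Proof. by rewrite /T -mulr_natl; field; rewrite gt_eqF. Qed.

Lemma Rintegral_cos_period (k : int) :
  \int[mu]_(t in `[0, T]) cos (omega * k%:~R * t) = T * (k == 0)%:R.
Proof.
(* The primitive divides by the frequency, so [k = 0], where the integrand is the constant 1, is
   separate. Otherwise the sine completes [k] whole turns and vanishes at both ends. *)
have [->|k0] := eqVneq k 0.
  under eq_Rintegral do rewrite mulr0 mul0r cos0.
  rewrite Rintegral_cst//= lebesgue_measure_itv/= lte_fin T_gt0.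
  by rewrite -EFinD/= subr0 mul1r mulr1.
rewrite Rintegral_cos// ?wkT ?sin_int2pi ?mul0r ?mulr0//.
by rewrite mulf_neq0 ?intr_eq0// gt_eqF.
Qed.

Lemma Rintegral_sin_period (k : int) :
  \int[mu]_(t in `[0, T]) sin (omega * k%:~R * t) = 0.
Proof.
have [->|k0] := eqVneq k 0.
  under eq_Rintegral do rewrite mulr0 mul0r sin0.
  by rewrite Rintegral_cst// mul0r.
rewrite Rintegral_sin// ?wkT ?cos_int2pi ?subrr ?mul0r//.
by rewrite mulf_neq0 ?intr_eq0// gt_eqF.
Qed.

(** By the product-to-sum formula only the frequencies [k - l] and [k + l] occur, and a cosine has
    nonzero integral only at frequency 0. The two indicators cancel when [k = l = 0]. *)
Lemma Rintegral_sinM_period (k l : int) :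
  \int[mu]_(t in `[0, T])
     (sin (omega * k%:~R * t) * sin (omega * l%:~R * t)) =
  T / 2 * ((k == l)%:R - (k == - l)%:R).
Proof.
transitivity (\int[mu]_(t in `[0, T]) (2^-1 *
    (cos (omega * (k - l)%:~R * t) - cos (omega * (k + l)%:~R * t)))).
  apply: eq_Rintegral => t _; rewrite intrB intrD.
  rewrite [omega * (_ - _)]mulrBr [omega * (_ + _)]mulrDr mulrBl mulrDl.
  by rewrite cosB cosD; field.
have ic m := continuous_integrable_itv 0 T (@continuous_cosMl (omega * m%:~R)).
rewrite RintegralZl//; last first.
  by apply: continuous_integrable_itv => t; apply: cvgB; exact: continuous_cosMl.
rewrite RintegralB// !Rintegral_cos_period subr_eq0 addr_eq0; ring.
Qed.

End period.
End integral.

(** * First-order Taylor expansion *)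

Section gradient.
Context {R : realType} {n : nat}.
Implicit Types (J : 'rV[R]_n -> R) (theta h : 'rV[R]_n).

Lemma diff_gradient J theta h : differentiable J theta ->
  'd J theta h = \sum_j gradient J theta 0 j * h 0 j.
Proof.
move=> dJ; rewrite [h in LHS]row_sum_delta linear_sum; apply: eq_bigr => j _.
by rewrite linearZ mxE deriveE//= mulrC.
Qed.

Definition taylor_remainder J theta h :=
  J (theta + h) - J theta - \sum_j gradient J theta 0 j * h 0 j.

(** This is the little-o of differentiability in epsilon-delta form. It is stated without a quotient
    so as to cover [h = 0], a value that the dither takes. *)
Lemma taylor_remainder_small J theta : differentiable J theta ->
  forall e, 0 < e -> exists2 d, 0 < d &
    forall h, `|h| < d -> `|taylor_remainder J theta h| <= e * `|h|.
Proof.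
move=> dJ e e0; have /eqaddoP/(_ e e0) := diff_locally dJ.
move=> /nbhs_ballP[d /= d0 Hd]; exists d => // h hd.
have := Hd h; rewrite -ball_normE /ball_/= sub0r normrN => /(_ hd).
rewrite /taylor_remainder -diff_gradient//=.
by rewrite [_ h]/= !fctE/= [h + theta]addrC opprD addrA.
Qed.

End gradient.

(** * Size of the dither, its correlations with the demodulation, and the estimation error *)

Section dither.
Context {R : realType} {n : nat}.
Variables (omega : R) (r : 'I_n -> int).
Implicit Types (a theta : 'rV[R]_n) (J : 'rV[R]_n -> R).
Notation mu := lebesgue_measure.

Lemma continuous_dither_coord a j :
  continuous (fun t => dither omega r a t 0 j).
Proof.
move=> t; under eq_fun do rewrite mxE.
by apply: cvgM; [exact: cvg_cst | exact: continuous_sinMl].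
Qed.

Lemma continuous_dither a : continuous (dither omega r a).
Proof. by move=> t; apply: cvg_row => i; exact: continuous_dither_coord. Qed.

Lemma continuous_demodulation a i : continuous (demodulation omega r a i).
Proof.
by move=> t; apply: cvgM; [exact: cvg_cst | exact: continuous_sinMl].
Qed.

Lemma normr_sin_le1 (x : R) : `|sin x| <= 1.
Proof. by rewrite ler_norml sin_geN1 sin_le1. Qed.

Lemma normr_demodulation_le a i t :
  `|demodulation omega r a i t| <= 2 / `|a 0 i|.
Proof.
rewrite !normrM normfV (@ger0_norm _ 2)//.
by rewrite ler_piMr ?normr_sin_le1// divr_ge0.
Qed.

(** The norm on the left is the maximum norm, while the amplitude is Euclidean: each entry is at
    most [|a_j|], the square root of one term of the sum. *)
Lemma normr_dither_le a t : `|dither omega r a t| <= dither_amplitude a.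
Proof.
rewrite {1}/Num.norm/= mx_normrE; apply: bigmax_le => [|[i j] _ /=].
  exact: sqrtr_ge0.
rewrite mxE normrM (le_trans (ler_piMr _ (normr_sin_le1 _)))//.
rewrite -sqrtr_sqr ler_wsqrtr// (bigD1 j)//= lerDl sumr_ge0// => k _.
exact: sqr_ge0.
Qed.

Hypotheses (omega_gt0 : 0 < omega) (r_neq0 : forall i, r i != 0)
  (r_distinct : forall i j, i != j -> `|r i| != `|r j|).
Let T := 2 * pi / omega.

Let T_gt0 : 0 < T.
Proof. by rewrite divr_gt0// mulr_gt0// pi_gt0. Qed.

Lemma Rintegral_demodulation a i :
  \int[mu]_(t in `[0, T]) demodulation omega r a i t = 0.
Proof.
rewrite RintegralZl//; last exact/continuous_integrable_itv/continuous_sinMl.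
by rewrite Rintegral_sin_period// mulr0.
Qed.

(** For [i = j] the factors [2 / a_i], [a_i] and [T / 2] multiply to [T], and [r_i != - r_i] because
    [r_i] is nonzero. For [i != j] the absolute values must differ, since sine is odd and opposite
    frequencies are correlated too. *)
Lemma Rintegral_demodulation_dither a i j : a 0 i != 0 ->
  \int[mu]_(t in `[0, T]) (demodulation omega r a i t * dither omega r a t 0 j) =
  T * (i == j)%:R.
Proof.
move=> ai0; transitivity (\int[mu]_(t in `[0, T]) (2 / a 0 i * a 0 j *
    (sin (omega * (r i)%:~R * t) * sin (omega * (r j)%:~R * t)))).
  by apply: eq_Rintegral => t _; rewrite mxE /demodulation; ring.
rewrite RintegralZl//; last first.
  by apply: continuous_integrable_itv => t; apply: cvgM; exact: continuous_sinMl.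
rewrite Rintegral_sinM_period//; have [<-|ij] := eqVneq i j.
  have -> : (r i == - r i) = false.
    by rewrite -addr_eq0 -mulr2n mulrn_eq0/= (negbTE (r_neq0 i)).
  by rewrite !eqxx subr0 !mulr1 -/T; field.
have /negbTE := r_distinct ij; rewrite eqr_norm2 => /norP[/negbTE-> /negbTE->].
by rewrite subr0 !mulr0.
Qed.

Lemma average_gradient_estimate_error J a theta i :
  (forall x, differentiable J x) -> a 0 i != 0 ->
  average_gradient_estimate J omega r a theta 0 i - gradient J theta 0 i =
  T^-1 * \int[mu]_(t in `[0, T]) (demodulation omega r a i t *
           taylor_remainder J theta (dither omega r a t)).
Proof.
move=> dJ ai0; rewrite mxE -/T.
set m := demodulation omega r a i; set s := dither omega r a.
set g := gradient J theta.
have cm : continuous m by exact: continuous_demodulation.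
have cs j : continuous (fun t => s t 0 j) by exact: continuous_dither_coord.
have cJ : continuous (fun t => J (theta + s t)).
  move=> t; apply: continuous_comp; last exact: differentiable_continuous.
  by apply: cvgD; [exact: cvg_cst | exact: continuous_dither].
have cms j : continuous (fun t => m t * s t 0 j).
  by move=> t; apply: cvgM; [exact: cm | exact: cs].
have cgms j : continuous (fun t => g 0 j * (m t * s t 0 j)).
  by move=> t; apply: cvgM; [exact: cvg_cst | exact: cms].
have cmJ : continuous (fun t => m t * J (theta + s t)).
  by move=> t; apply: cvgM; [exact: cm | exact: cJ].
have cmc : continuous (fun t => m t * J theta).
  by move=> t; apply: cvgM; [exact: cm | exact: cvg_cst].
(* The remainder is split into the sampled value of [J], the constant [J theta], which the zero mean
   of [m] removes, and the linear terms, of which orthogonality leaves only [T * g 0 i]. *)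
have -> : \int[mu]_(t in `[0, T]) (m t * taylor_remainder J theta (s t)) =
    \int[mu]_(t in `[0, T]) ((m t * J (theta + s t) - m t * J theta) -
       \sum_j g 0 j * (m t * s t 0 j)).
  apply: eq_Rintegral => t _; rewrite /taylor_remainder !mulrBr mulr_sumr.
  by congr (_ - _); apply: eq_bigr => j _; rewrite mulrCA.
rewrite RintegralB//; last 2 first.
- by apply: continuous_integrable_itv => t; apply: cvgB; [exact: cmJ | exact: cmc].
- by apply: continuous_integrable_itv; exact: continuous_sumr.
rewrite RintegralB//; try exact: continuous_integrable_itv.
rewrite RintegralZr//; last exact: continuous_integrable_itv.
rewrite Rintegral_demodulation mul0r subr0 Rintegral_sum_continuous//.
under [in RHS]eq_bigr => j _.
  rewrite RintegralZl//; last exact: continuous_integrable_itv.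
  rewrite Rintegral_demodulation_dither//; over.
rewrite (bigD1 i)//= eqxx mulr1 big1 ?addr0; last first.
  by move=> j ji; rewrite eq_sym (negbTE ji) !mulr0.
by rewrite mulrBr mulrCA mulVf ?mulr1// gt_eqF.
Qed.

(** Multiplying [|m_i| <= 2 / |a_i|] by the remainder bound [e * a_0] leaves only the ratio
    [a_i / a_0], which stays fixed along the limit; the small amplitude in the denominator does no
    harm. *)
Lemma average_gradient_estimate_error_le J a theta i e :
  (forall x, differentiable J x) -> a 0 i != 0 -> 0 <= e ->
  (forall t, `|taylor_remainder J theta (dither omega r a t)| <=
     e * `|dither omega r a t|) ->
  `|average_gradient_estimate J omega r a theta 0 i - gradient J theta 0 i| <=
  2 * e / `|a 0 i / dither_amplitude a|.
Proof.
move=> dJ ai0 e0 small; rewrite average_gradient_estimate_error// normrM.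
have a_ge0 : 0 <= dither_amplitude a by exact: sqrtr_ge0.
have Ti0 : 0 < T^-1 by rewrite invr_gt0.
rewrite (gtr0_norm Ti0) mulrC ler_pdivrMr//.
(* The factor [T] is the length [T - 0] of the segment. *)
rewrite -{2}[T]subr0; apply: normr_Rintegral_le; first exact: ltW.
  move=> t; apply: cvgM; first exact: continuous_demodulation.
  have cs := @continuous_dither a.
  apply: cvgB; last first.
    apply: continuous_sumr => j u; apply: cvgM; first exact: cvg_cst.
    exact: continuous_dither_coord.
  apply: cvgB; last exact: cvg_cst.
  apply: (@continuous_comp _ _ _ (fun u => theta + dither omega r a u) J).
    by apply: cvgD; [exact: cvg_cst | exact: cs].
  exact: differentiable_continuous.
move=> t; rewrite normrM normf_div (ger0_norm a_ge0) invf_div.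
rewrite [leRHS](_ : _ = 2 / `|a 0 i| * (e * dither_amplitude a)); last by ring.
apply: ler_pM => //; first exact: normr_demodulation_le.
by apply: le_trans (small t) _; rewrite ler_wpM2l// normr_dither_le.
Qed.

End dither.

(** * Passage to the limit along vanishing dithers *)

Theorem lemma2 (R : realType) (n : nat) (J : 'rV[R]_n -> R)
    (omega : R) (r : 'I_n -> int) (c : 'rV[R]_n)
    (J_C1 : continuously_differentiable J)
    (omega_gt0 : 0 < omega)
    (r_neq0 : forall i, r i != 0)
    (r_distinct : forall i j, i != j -> `|r i| != `|r j|)
    (theta : 'rV[R]_n) :
  average_gradient_estimate J omega r a theta @[a --> vanishing_dither c]
    --> gradient J theta.
Proof.
case: J_C1 => dJ _; apply: cvg_row => i; apply/cvgrPdist_le => eps eps0.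
have [ci0|ci_neq0] := eqVneq (c 0 i) 0.
  (* No vector of nonzero amplitudes has a zero ratio. *)
  exists 1 => //= a [a_neq0 ac _]; exfalso.
  have /eqP := ac i; rewrite ci0 mulf_eq0 (negbTE (a_neq0 i)) invr_eq0 /=.
  rewrite sqrtr_eq0 leNgt (bigD1 i)//= ltr_wpDr ?sumr_ge0// => [|].
    by move=> j _; exact: sqr_ge0.
  by rewrite exprn_even_gt0//= a_neq0.
have ci_gt0 : 0 < `|c 0 i| by rewrite normr_gt0.
(* Chosen so that the error bound [2 * e / |c_i|] equals [eps]; it is positive since [c_i] is
   nonzero. *)
pose e := eps * `|c 0 i| / 2.
have e0 : 0 < e by rewrite divr_gt0// mulr_gt0.
have [d d0 small] := taylor_remainder_small (dJ theta) e0.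
exists d => //= a [a_neq0 ac ad]; rewrite distrC.
have -> : eps = 2 * e / `|a 0 i / dither_amplitude a|.
  by rewrite ac /e; field; rewrite gt_eqF.
apply: average_gradient_estimate_error_le => //; first exact: ltW.
(* The whole dither orbit lies within the radius [d], because [|s(t)| <= a_0 < d] for every [t]. *)
by move=> t; apply: small; rewrite (le_lt_trans (normr_dither_le _ _ _ _)).
Qed.
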